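(* Let $n\ge 1$, let $A$ be an $n\times n$ matrix and $b$ a column vector with $n$ components, both with entries in $\mathbb{R}\cup\{-\infty\}$. Suppose that $\lim_{k\to+\infty}A^{k}$ exists and equals the null matrix $O$ (all of whose entries are $-\infty$), powers being taken in the $(\max,+)$-algebra. Then the greatest solution $x\in(\mathbb{R}\cup\{-\infty\})^n$ of the vector inequality $$x\le Ax+b$$ is $$x=A^{*}b,\qquad A^{*}:=I+A+A^{2}+A^{3}+\cdots=I+A+A^{2}+\cdots+A^{n-1},$$ and this greatest solution coincides with the solution of the equation $x=Ax+b$.
   Context: All operations are in the $(\max,+)$-algebra on $\mathbb{R}\cup\{-\infty\}$: the sum $a+b$ denotes $\max(a,b)$ and the product $ab$ denotes the usual sum of $a$ and $b$. The neutral element of addition is $-\infty$, which is absorbing for the product, and the neutral element of the product is $0$. The order $\le$ is the usual one, with $-\infty$ as least element. For matrices, addition is entrywise, $(AB)_{i,j}=\max_k(a_{i,k}+b_{k,j})$ (usual sum inside the maximum), and $\le$ is the entrywise order, for vectors as well. $I$ is the identity matrix ($0$ on the diagonal, $-\infty$ elsewhere). The limit $\lim_k A^k=O$ is entrywise: every entry of $A^k$ tends to $-\infty$. *)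

(* Defs.v *)
From HB Require Import structures.
From mathcomp Require Import all_boot all_order all_algebra.
From mathcomp Require Import all_classical all_reals all_analysis.

Set Implicit Arguments.
Unset Strict Implicit.
Unset Printing Implicit Defensive.

Import Order.TTheory GRing.Theory Num.Theory.
Local Open Scope classical_set_scope.
Local Open Scope ring_scope.

(* R U {-oo}, as the subtype of the extended reals that excludes +oo. *)
Record maxplus (R : realType) :=
  Maxplus { mpval : \bar R ; mpvalP : (mpval < +oo)%E }.

Section Maxplus.
Variable R : realType.
Implicit Types x y z : maxplus R.

HB.instance Definition _ := [isSub for @mpval R].
HB.instance Definition _ := [Choice of maxplus R by <:].
HB.instance Definition _ := 
  [SubChoice_isSubOrder of maxplus R by <: with ring_display].

Lemma mp_zeroP : (-oo < +oo :> \bar R)%E.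
Proof. by []. Qed.

Lemma mp_oneP : (0%:E < +oo :> \bar R)%E.
Proof. exact: ltry. Qed.

Lemma mp_addP x y : (maxe (mpval x) (mpval y) < +oo)%E.
Proof. by rewrite gt_max !mpvalP. Qed.

Lemma mp_mulP x y : (mpval x + mpval y < +oo)%E.
Proof. exact: (lte_add_pinfty (mpvalP x) (mpvalP y)). Qed.

Definition mp_zero : maxplus R := Maxplus mp_zeroP.
Definition mp_one : maxplus R := Maxplus mp_oneP.
Definition mp_add x y : maxplus R := Maxplus (mp_addP x y).
Definition mp_mul x y : maxplus R := Maxplus (mp_mulP x y).

Lemma mp_addA : associative mp_add.
Proof. by move=> x y z; apply: val_inj; exact: maxA. Qed.

Lemma mp_addC : commutative mp_add.
Proof. by move=> x y; apply: val_inj; exact: maxC. Qed.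

Lemma mp_add0 : left_id mp_zero mp_add.
Proof. by move=> x; apply: val_inj; exact: maxNye. Qed.

Lemma mp_mulA : associative mp_mul.
Proof. by move=> x y z; apply: val_inj; exact: addeA. Qed.

Lemma mp_mulC : commutative mp_mul.
Proof. by move=> x y; apply: val_inj; exact: addeC. Qed.

Lemma mp_mul1 : left_id mp_one mp_mul.
Proof. by move=> x; apply: val_inj; exact: add0e. Qed.

Lemma mp_mulDl : left_distributive mp_mul mp_add.
Proof. by move=> x y z; apply: val_inj; exact: adde_maxl. Qed.

Lemma mp_mul0 : left_zero mp_zero mp_mul.
Proof. by move=> x; apply: val_inj; exact: addNye. Qed.

Lemma mp_one_neq0 : mp_one != mp_zero.
Proof. by []. Qed.

HB.instance Definition _ :=
  GRing.isNmodule.Build (maxplus R) mp_addA mp_addC mp_add0.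
HB.instance Definition _ :=
  GRing.Nmodule_isComNzSemiRing.Build (maxplus R)
    mp_mulA mp_mulC mp_mul1 mp_mulDl mp_mul0 mp_one_neq0.

(* The topology induced by \bar R, for which x_k --> 0 (that is, -oo) means
   that x_k tends to -oo in the usual sense. Matrices over [maxplus R] then
   carry the library's topology of entrywise convergence. *)
HB.instance Definition _ := isPointed.Build (maxplus R) mp_zero.
HB.instance Definition _ :=
  Topological.copy (maxplus R) (initial_topology (@mpval R)).

End Maxplus.

Definition mxle (R : realType) (m n : nat) (A B : 'M[maxplus R]_(m, n)) :=
  forall i j, A i j <= B i j.

Definition star_partial (R : realType) (n : nat) (A : 'M[maxplus R]_n)
  (m : nat) : 'M[maxplus R]_n := \sum_(0 <= k < m) A ^+ k.

(* A^* as the infinite sum I + A + A^2 + ...; as usual, [lim] is meaningful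
   only when the partial sums converge in R U {-oo}. *)
Definition star (R : realType) (n : nat) (A : 'M[maxplus R]_n) :
  'M[maxplus R]_n := lim (star_partial A @ \oo).

Definition is_greatest_solution (R : realType) (n : nat)
    (A : 'M[maxplus R]_n) (b x : 'cV[maxplus R]_n) : Prop :=
  mxle x (A *m x + b) /\
  forall y : 'cV[maxplus R]_n, mxle y (A *m y + b) -> mxle y x.

(* Main.v *)
Require Import Defs.
From HB Require Import structures.
From mathcomp Require Import all_boot all_order all_algebra.
From mathcomp Require Import all_classical all_reals all_analysis.

Set Implicit Arguments.
Unset Strict Implicit.
Unset Printing Implicit Defensive.

Import Order.TTheory GRing.Theory Num.Theory.
Local Open Scope classical_set_scope.
Local Open Scope ring_scope.

(** If some diagonal entry of [A ^+ k], [k > 0], were at least [1] (the real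
    number 0), so would be that entry of all [A ^+ (k * m)], against
    [A ^+ k --> 0]; hence closed walks have weight at most [1]. Cutting closed
    walks out of long ones gives [A ^+ k <= I + ... + A ^+ n.-1] for every [k],
    so the partial sums of the star are constant from [n] on, and
    [A^* = A A^* + I]. Iterating [x <= A x + b] yields
    [x <= A ^+ k x + (I + ... + A ^+ k.-1) b], where the first term vanishes in
    the limit; iterating [A x + b <= x] yields [A^* b <= x]. *)

(** * Order on the scalars, where addition is a maximum *)

Section MaxplusOrder.
Variable R : realType.
Implicit Types x y z t : maxplus R.

Lemma mp_leE x y : (x <= y) = (mpval x <= mpval y)%E.
Proof. by []. Qed.

Lemma mp_ltE x y : (x < y) = (mpval x < mpval y)%E.
Proof. by rewrite !ltNge. Qed.

Lemma mp_ge0 x : (0 : maxplus R) <= x.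
Proof. by rewrite mp_leE; exact: leNye. Qed.

Lemma mp_ge_add x y z : (x + y <= z) = (x <= z) && (y <= z).
Proof. by rewrite !mp_leE; exact: ge_max. Qed.

Lemma mp_le_addl x y : x <= x + y.
Proof. by have := lexx (x + y); rewrite mp_ge_add => /andP[]. Qed.

Lemma mp_le_addr x y : x <= y + x.
Proof. by rewrite addrC mp_le_addl. Qed.

Lemma mp_addr_idPl x y : reflect (x + y = x) (y <= x).
Proof.
apply: (iffP idP) => [yx|<-]; last exact: mp_le_addr.
by apply/le_anti; rewrite mp_ge_add lexx yx mp_le_addl.
Qed.

Lemma mp_le_add2 x y z t : x <= y -> z <= t -> x + z <= y + t.
Proof.
move=> xy zt; rewrite mp_ge_add (le_trans xy) ?mp_le_addl //.
by rewrite (le_trans zt) ?mp_le_addr.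
Qed.

Lemma mp_le_mul x y z t : x <= y -> z <= t -> x * z <= y * t.
Proof. by rewrite !mp_leE; exact: leeD. Qed.

Lemma mp_exp_ge1 x k : (1 : maxplus R) <= x -> (1 : maxplus R) <= x ^+ k.
Proof.
move=> x1; elim: k => [|k IH]; rewrite ?expr0 // exprS.
by rewrite -[leLHS]mulr1; exact: mp_le_mul.
Qed.

Lemma mp_add_sel x y : x + y = x \/ x + y = y.
Proof.
have [yx|/ltW xy] := leP y x; first by left; apply/mp_addr_idPl.
by right; rewrite addrC; apply/mp_addr_idPl.
Qed.

Lemma mp_le_sum (I : eqType) (r : seq I) (F : I -> maxplus R) i :
  i \in r -> F i <= \sum_(j <- r) F j.
Proof.
elim: r => // k r IH; rewrite inE big_cons => /predU1P[->|/IH].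
  exact: mp_le_addl.
by move=> /le_trans; apply; exact: mp_le_addr.
Qed.

Lemma mp_sum_le (I : Type) (r : seq I) (F : I -> maxplus R) x :
  (forall i, F i <= x) -> \sum_(i <- r) F i <= x.
Proof.
move=> Fx; apply: (big_ind (fun y => y <= x)) => //; first exact: mp_ge0.
by move=> y z yx zx; rewrite mp_ge_add yx.
Qed.

(** A finite maximum is attained; the alternative [0], that is $-\infty$, covers the empty sum. *)
Lemma mp_sum_sel (I : Type) (r : seq I) (F : I -> maxplus R) :
  \sum_(i <- r) F i = 0 \/ exists i, \sum_(i <- r) F i = F i.
Proof.
elim: r => [|k r IH]; first by left; rewrite big_nil.
rewrite big_cons; have [->|->] := mp_add_sel (F k) (\sum_(j <- r) F j) => //.
by right; exists k.
Qed.

End MaxplusOrder.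

(** * Entrywise order on matrices *)

Section MatrixOrder.
Variable R : realType.

Lemma mxle_trans m n (A B C : 'M[maxplus R]_(m, n)) :
  mxle A B -> mxle B C -> mxle A C.
Proof. by move=> AB BC i j; exact: le_trans (AB i j) (BC i j). Qed.

Lemma mxle_anti m n (A B : 'M[maxplus R]_(m, n)) :
  mxle A B -> mxle B A -> A = B.
Proof. by move=> AB BA; apply/matrixP => i j; apply/le_anti; rewrite AB BA. Qed.

Lemma mxle_add2r m n (A B C : 'M[maxplus R]_(m, n)) :
  mxle A B -> mxle (A + C) (B + C).
Proof. by move=> AB i j; rewrite !mxE; exact: mp_le_add2. Qed.

Lemma mulmx_ge_entry m n p (A : 'M[maxplus R]_(m, n))
    (B : 'M[maxplus R]_(n, p)) i j k :
  A i j * B j k <= (A *m B) i k.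
Proof.
rewrite mxE; apply: (mp_le_sum (fun j => A i j * B j k)).
exact: mem_index_enum.
Qed.

Lemma mxle_mulmx2l m n p (A : 'M[maxplus R]_(m, n))
    (B C : 'M[maxplus R]_(n, p)) :
  mxle B C -> mxle (A *m B) (A *m C).
Proof.
move=> BC i k; rewrite mxE; apply: mp_sum_le => j.
by apply: (le_trans _ (mulmx_ge_entry A C i j k)); exact: mp_le_mul.
Qed.

End MatrixOrder.

(** * Matrix powers as optimal walk weights *)

Section Walks.
Variables (R : realType) (n : nat) (A : 'M[maxplus R]_n).
Implicit Types (i j : 'I_n) (p q : seq 'I_n).

(** [p] lists the vertices visited after the start [i], so [size p] counts the edges. *)
Fixpoint walk_weight i p : maxplus R :=
  if p is j :: p' then A i j * walk_weight j p' else 1.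

Lemma walk_weight_cat i p q :
  walk_weight i (p ++ q) = walk_weight i p * walk_weight (last i p) q.
Proof.
by elim: p i => [|j p IH] i /=; rewrite ?mul1r // IH mulrA.
Qed.

Lemma walk_weight_le_pow i p :
  walk_weight i p <= (A ^+ size p) i (last i p).
Proof.
elim: p i => [|j p IH] i /=; first by rewrite expr0 mxE eqxx.
rewrite exprS; apply: (le_trans _ (mulmx_ge_entry A _ i j _)).
exact: mp_le_mul.
Qed.

(** The maximum in each matrix product is attained, so an optimal walk is built edge by edge. The
    alternative [0] covers the off-diagonal entries of [A ^+ 0]. *)
Lemma pow_eq_walk_weight k i j :
  (A ^+ k) i j = 0 \/
  exists p, [/\ size p = k, last i p = j & (A ^+ k) i j = walk_weight i p].
Proof.
elim: k i => [|k IH] i.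
  rewrite expr0 mxE; case: eqP => [->|_]; last by left.
  by right; exists [::].
rewrite exprS mxE.
have [->|[l ->]] :=
  mp_sum_sel (index_enum 'I_n) (fun l => A i l * (A ^+ k) l j); first by left.
have [->|[p [<- lp ->]]] := IH l; first by left; rewrite mulr0.
by right; exists (l :: p).
Qed.

(** Repeating a closed walk of length [k] [m] times gives a closed walk of length [k * m]. *)
Lemma pow_diag_supermul i k m : (A ^+ k) i i ^+ m <= (A ^+ (k * m)) i i.
Proof.
elim: m => [|m IH]; first by rewrite muln0 !expr0 mxE eqxx.
rewrite exprS mulnS exprD; apply: (le_trans _ (mulmx_ge_entry _ _ i i i)).
exact: mp_le_mul.
Qed.

End Walks.

(** For a walk from [x] through [s], the block [s2] is a nonempty closed walk that can be cut out:
    it starts and ends at [last x s1]. *)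
Lemma not_uniq_split (T : eqType) (x : T) (s : seq T) : ~~ uniq (x :: s) ->
  exists s1 s2 s3, [/\ s = s1 ++ s2 ++ s3, s2 != [::] &
    last (last x s1) s2 = last x s1].
Proof.
elim: s x => // y s IH x.
have [xs _|xs] := boolP (x \in y :: s).
  case/splitPr: xs => s1 s2; exists [::], (rcons s1 x), s2.
  by rewrite cat_rcons last_rcons; split => //; case: s1.
rewrite cons_uniq xs => /IH[s1 [s2 [s3 [-> s2N e]]]].
by exists (y :: s1), s2, s3.
Qed.

(** * Partial sums of the star and their stationarity *)

Section Star.
Variables (R : realType) (n : nat) (A : 'M[maxplus R]_n).

Lemma star_partial_ge_pow k m : (k < m)%N -> mxle (A ^+ k) (star_partial A m).
Proof.
move=> km i j; rewrite /star_partial summxE.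
by apply: (mp_le_sum (fun k => (A ^+ k) i j)); rewrite mem_index_iota.
Qed.

Lemma star_partialS k : star_partial A k.+1 = A *m star_partial A k + 1%:M.
Proof.
rewrite /star_partial big_nat_recl // expr0 addrC; congr (_ + _).
by rewrite [RHS]mulr_sumr; apply: eq_bigr => l _; rewrite exprS.
Qed.

Lemma star_partialS_mul m (b : 'M[maxplus R]_(n, m)) k :
  star_partial A k.+1 *m b = A *m (star_partial A k *m b) + b.
Proof. by rewrite star_partialS mulmxDl mul1mx mulmxA. Qed.

Lemma le_star_partial m (b x : 'M[maxplus R]_(n, m)) k : mxle x (A *m x + b) ->
  mxle x (A ^+ k *m x + star_partial A k *m b).
Proof.
move=> xle; elim: k => [|k IH].
  by rewrite expr0 mul1mx => i j; rewrite mxE mp_le_addl.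
apply: mxle_trans xle _; apply: mxle_trans (mxle_add2r b (mxle_mulmx2l A IH)) _.
rewrite mulmxDr star_partialS_mul exprS mulmxA addrA => i j; exact: lexx.
Qed.

Lemma star_partial_mul_le m (b x : 'M[maxplus R]_(n, m)) k :
  mxle (A *m x + b) x -> mxle (star_partial A k *m b) x.
Proof.
move=> lex; elim: k => [|k IH].
  by rewrite /star_partial big_nil mul0mx => i j; rewrite mxE mp_ge0.
rewrite star_partialS_mul.
exact: mxle_trans (mxle_add2r b (mxle_mulmx2l A IH)) lex.
Qed.

Hypothesis A_diag : forall k i, (0 < k)%N -> (A ^+ k) i i <= 1.

(* A walk of length at least [n] revisits a vertex; deleting the closed walk in
   between, whose weight is at most [1], does not decrease the weight. *)
Lemma walk_weight_le_star_partial i p :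
  walk_weight A i p <= star_partial A n i (last i p).
Proof.
have [m] := ubnP (size p); elim: m i p => // m IH i p; rewrite ltnS => pm.
have [pn|np] := ltnP (size p) n.
  exact: le_trans (walk_weight_le_pow A i p) (star_partial_ge_pow pn _ _).
have /not_uniq_split[p1 [p2 [p3 [pE p2N p2l]]]] : ~~ uniq (i :: p).
  apply/negP => /card_uniqP ip; have := max_card (mem (i :: p)).
  by rewrite ip card_ord ltnNge np.
have p2_gt0 : (0 < size p2)%N by case: (p2) p2N.
have := IH i (p1 ++ p3); rewrite pE !walk_weight_cat !last_cat p2l.
move=> {}IH; apply: le_trans (IH _); last first.
  apply: leq_trans pm; rewrite pE !size_cat ltn_add2l.
  by rewrite -[ltnLHS]add0n ltn_add2r.
apply: mp_le_mul => //; rewrite -[leRHS]mul1r; apply: mp_le_mul => //.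
apply: le_trans (walk_weight_le_pow _ _ _) _.
by rewrite p2l; exact: A_diag.
Qed.

Lemma pow_le_star_partial k : mxle (A ^+ k) (star_partial A n).
Proof.
move=> i j; have [->|[p [_ <- ->]]] := pow_eq_walk_weight A k i j.
  exact: mp_ge0.
exact: walk_weight_le_star_partial.
Qed.

Lemma star_partial_stationary m : (n <= m)%N ->
  star_partial A m = star_partial A n.
Proof.
move=> nm; apply: mxle_anti => i j.
  rewrite [leLHS]summxE; apply: mp_sum_le => k; exact: pow_le_star_partial.
(* [big_seq] retains [k < n], hence [k < m]: each term also occurs in the longer sum. *)
rewrite [leLHS]summxE big_seq.
apply: (big_ind (fun x => x <= star_partial A m i j)).
- exact: mp_ge0.
- by move=> x y xle yle; rewrite mp_ge_add xle.
- move=> k; rewrite mem_index_iota => /andP[_ kn].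
  by apply: star_partial_ge_pow; exact: leq_trans nm.
Qed.

End Star.

(** * Entrywise convergence and its consequences *)

Section Topology.

(** If all neighbourhoods of two points meet, the same holds for their images under each [f i],
    which therefore agree. *)
Lemma hausdorff_separating (I : Type) (T U : topologicalType)
    (f : I -> T -> U) :
  hausdorff_space U -> (forall i, continuous (f i)) ->
  (forall x y, (forall i, f i x = f i y) -> x = y) -> hausdorff_space T.
Proof.
move=> hU cf sf x y xy; apply: sf => i; apply: hU => P Q Px Qy.
have [z [Pz Qz]] := xy _ _ (cf i x P Px) (cf i y Q Qy).
by exists (f i z).
Qed.

Lemma mx_entry_continuous (T : topologicalType) m n (i : 'I_m) (j : 'I_n) :
  continuous (fun A : 'M[T]_(m, n) => A i j).
Proof.
move=> A P AP; exists (fun i' j' => if (i' == i) && (j' == j) then P else setT).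
  move=> i' j'; case: ifP => [/andP[/eqP -> /eqP ->]//|_]; exact: filterT.
by move=> B /(_ i j); rewrite !eqxx.
Qed.

Variables (R : realType).

Lemma mpval_continuous : continuous (@mpval R).
Proof. exact: initial_continuous. Qed.

Lemma mx_mpval_continuous m n (i : 'I_m) (j : 'I_n) :
  continuous (fun A : 'M[maxplus R]_(m, n) => mpval (A i j)).
Proof.
move=> A.
apply: (@continuous_comp _ _ _ (fun A : 'M[maxplus R]_(m, n) => A i j)).
  exact: mx_entry_continuous.
exact: mpval_continuous.
Qed.

(** Makes limits unique, so that the star equals the eventual value of its partial sums. *)
Lemma mx_maxplus_hausdorff m n : hausdorff_space 'M[maxplus R]_(m, n).
Proof.
apply: (@hausdorff_separating _ 'M[maxplus R]_(m, n) (\bar R)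
  (fun (ij : 'I_m * 'I_n) A => mpval (A ij.1 ij.2))).
- exact: ereal_hausdorff.
- by move=> ij; exact: mx_mpval_continuous.
- move=> A B AB; apply/matrixP => i j; apply: val_inj; exact: (AB (i, j)).
Qed.

Variables (n : nat) (A : 'M[maxplus R]_n).
Hypothesis A0 : A ^+ k @[k --> \oo] --> (0 : 'M[maxplus R]_n).

Lemma near_pow_mul_lt i j (x y : maxplus R) : (0 : maxplus R) < x ->
  \forall k \near \oo, (A ^+ k) i j * y < x.
Proof.
have Aij : mpval ((A ^+ k) i j) @[k --> \oo] --> -oo%E.
  have -> : -oo%E = mpval ((0 : 'M[maxplus R]_n) i j) by rewrite mxE.
  apply: (@cvg_comp _ _ _ (fun k => A ^+ k)
    (fun B : 'M[maxplus R]_n => mpval (B i j)) _ _ _ A0).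
  exact: mx_mpval_continuous.
(* Here [x] is real: its type excludes [+oo] and [0 < x] excludes [-oo]. A real [y] only shifts the
   threshold to [x - y]; for [y = -oo] the product is [-oo]. *)
rewrite mp_ltE; case: x => -[x| |] //= xP _; case: y => -[y| |] //= yP.
  have /cvgeNyPlt/(_ (x - y)) := Aij.
  apply: filterS => k Ak; rewrite mp_ltE /=.
  by rewrite -lteBrDr//.
by apply: nearW => k; rewrite mp_ltE /= addeNy ltNyr.
Qed.

Lemma pow_diag_le1 k i : (0 < k)%N -> (A ^+ k) i i <= 1.
Proof.
move=> k0; rewrite leNgt; apply/negP => /ltW Ak.
have : \forall m \near \oo, (A ^+ m) i i * 1 < 1.
  by apply: near_pow_mul_lt; rewrite mp_ltE /= ltNyr.
(* The exponent [k * N] is at least [N] and a multiple of [k], so the entry there is both below [1]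
   and at least [1]. *)
case=> N _ /(_ (k * N)%N); rewrite /= leq_pmull // => /(_ isT).
rewrite mulr1 ltNge (le_trans _ (pow_diag_supermul A i k N)) //.
exact: mp_exp_ge1.
Qed.

Lemma mulmx_le_of_pow_cvg0 m (x y : 'M[maxplus R]_(n, m)) :
  (\forall k \near \oo, mxle x (A ^+ k *m x + y)) -> mxle x y.
Proof.
move=> xle i j; rewrite leNgt; apply/negP => yx.
have x0 : (0 : maxplus R) < x i j by apply: le_lt_trans yx; exact: mp_ge0.
have : \forall k \near \oo, forall l, (A ^+ k) i l * x l j < x i j.
  by apply: filter_forall => l; exact: near_pow_mul_lt.
move=> Ax; have [k [xk Ak]] := filter_ex (filterI xle Ax).
have := xk i j; rewrite !mxE leNgt => /negP; apply.
(* The right-hand side is [y i j], a single product, or [0]; each is strictly below [x i j]. *)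
have [->|->] := mp_add_sel (\sum_l (A ^+ k) i l * x l j) (y i j) => //.
by have [->|[l ->]] :=
  mp_sum_sel (index_enum 'I_n) (fun l => (A ^+ k) i l * x l j).
Qed.

End Topology.

Theorem mainTheorem1 (R : realType) (n : nat) (hn : (1 <= n)%N)
    (A : 'M[maxplus R]_n) (b : 'cV[maxplus R]_n)
    (hA : A ^+ k @[k --> \oo] --> (0 : 'M[maxplus R]_n)) :
  [/\ cvg (star_partial A @ \oo),
      star A = \sum_(0 <= k < n) A ^+ k,
      is_greatest_solution A b (star A *m b)
    & forall x : 'cV[maxplus R]_n, x = A *m x + b <-> x = star A *m b].
Proof.
have stat := star_partial_stationary (pow_diag_le1 hA).
have near_stat : \forall k \near \oo, star_partial A k = star_partial A n.
  by exists n => // k /= /stat.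
have starE : star A = star_partial A n.
  exact: (lim_near_cst (@mx_maxplus_hausdorff R n n) near_stat).
have fixb : star A *m b = A *m (star A *m b) + b.
  (* The recursion leads from [n] to [n.+1], where the partial sum is unchanged. *)
  by rewrite starE -star_partialS_mul stat.
have greatest y : mxle y (A *m y + b) -> mxle y (star A *m b).
  move=> yle; apply: (mulmx_le_of_pow_cvg0 hA).
  apply: filterS near_stat => k kE; rewrite starE -kE.
  exact: le_star_partial.
split => //.
- by apply: cvgP; exact: cvg_near_cst near_stat.
- by split => //; rewrite -fixb => i j.
- move=> x; split => [xE|->] //.
  (* A solution of the equation satisfies both inequalities: one bounds it above by the greatest
     solution, the other below by the partial sum applied to [b]. *)
  apply: mxle_anti; first by apply: greatest; rewrite -xE => i j.
  by rewrite starE; apply: star_partial_mul_le; rewrite -xE => i j.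
Qed.
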